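(* Let $A\subseteq\mathbb{N}$ and let $A'$ be the Turing jump of $A$. A partial function $G:\mathbf{2}^*\to\mathbb{Z}$ is partial $A'$-recursive if and only if there exist total $A$-recursive functions $f,g:\mathbf{2}^*\times\mathbb{N}\to\mathbb{N}$ such that, for all $p\in\mathbf{2}^*$, $$G(p)=\max\{f(p,t):t\in\mathbb{N}\}-\max\{g(p,t):t\in\mathbb{N}\}$$ (in particular, $G(p)$ is defined if and only if both maxima are finite).
   Context: $\mathbf{2}^*$ is the set of finite binary words. The maximum of an infinite (unbounded) set of integers is undefined, and a difference is defined iff both terms are. *)

(* Defs.v *)
From Stdlib Require Import Arith Lia List ZArith Cantor.
Import ListNotations.

(** Partial recursive functions relative to an oracle.  All functions are unary
    on [nat]; several arguments are packed with the bijection [Cantor.to_nat]. *)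

Notation "⟨ x , y ⟩" := (Cantor.to_nat (x, y)) (at level 0, format "⟨ x ,  y ⟩").

Inductive code : Set :=
| Zero | Succ | Left | Right | Oracle
| Pair (f g : code)
| Comp (f g : code)
| Prec (f g : code)
| Mu (f : code).

(** Graph of the function defined from [f] and [g] by primitive recursion:
    h(a, 0) = f(a) and h(a, n + 1) = g(a, n, h(a, n)). *)
Fixpoint prec_graph (f g : nat -> nat -> Prop) (a n y : nat) : Prop :=
  match n with
  | 0 => f a y
  | S m => exists u, prec_graph f g a m u /\ g ⟨a, ⟨m, u⟩⟩ y
  end.

(** [eval A c x y]: the program [c] with oracle [A] halts on [x] with output [y].
    [Oracle] is the characteristic function of [A]. *)
Fixpoint eval (A : nat -> Prop) (c : code) (x y : nat) : Prop :=
  match c with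
  | Zero => y = 0
  | Succ => y = S x
  | Left => y = fst (Cantor.of_nat x)
  | Right => y = snd (Cantor.of_nat x)
  | Oracle => (A x /\ y = 1) \/ (~ A x /\ y = 0)
  | Pair f g => exists u v, eval A f x u /\ eval A g x v /\ y = ⟨u, v⟩
  | Comp f g => exists u, eval A g x u /\ eval A f u y
  | Prec f g => prec_graph (eval A f) (eval A g)
                  (fst (Cantor.of_nat x)) (snd (Cantor.of_nat x)) y
  | Mu f => eval A f ⟨x, y⟩ 0 /\
            forall k, k < y -> exists v, eval A f ⟨x, k⟩ (S v)
  end.

Lemma eval_functional A c x y y' : eval A c x y -> eval A c x y' -> y = y'.
Proof.
revert x y y'; induction c as [| | | | |f IHf g IHg|f IHf g IHg|f IHf g IHg|f IHf];
  simpl; intros x y y'.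
- congruence.
- congruence.
- congruence.
- congruence.
- intuition congruence.
- intros (u & v & Hu & Hv & ->) (u' & v' & Hu' & Hv' & ->).
  now rewrite (IHf _ _ _ Hu Hu'), (IHg _ _ _ Hv Hv').
- intros (u & Hu & Hy) (u' & Hu' & Hy').
  rewrite (IHg _ _ _ Hu Hu') in Hy; exact (IHf _ _ _ Hy Hy').
- generalize (fst (of_nat x)) (snd (of_nat x)); intros a n; revert y y'.
  induction n as [|n IHn]; simpl; intros y y'; [now apply IHf|].
  intros (u & Hu & Hy) (u' & Hu' & Hy').
  rewrite (IHn _ _ Hu Hu') in Hy; exact (IHg _ _ _ Hy Hy').
- intros [H0 Hlt] [H0' Hlt'].
  destruct (Nat.lt_trichotomy y y') as [H|[H|H]]; [|exact H|].
  + destruct (Hlt' _ H) as [v Hv]; discriminate (IHf _ _ _ H0 Hv).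
  + destruct (Hlt _ H) as [v Hv]; discriminate (IHf _ _ _ H0' Hv).
Qed.

(** Gödel numbering of programs, a bijection onto [nat]. *)
Fixpoint index (c : code) : nat :=
  match c with
  | Zero => 0
  | Succ => 1
  | Left => 2
  | Right => 3
  | Oracle => 4
  | Pair f g => 5 + 4 * ⟨index f, index g⟩
  | Comp f g => 6 + 4 * ⟨index f, index g⟩
  | Prec f g => 7 + 4 * ⟨index f, index g⟩
  | Mu f => 8 + 4 * index f
  end.

Lemma index_inj c d : index c = index d -> c = d.
Proof.
revert d; induction c; intros []; cbn [index]; intros H; try lia; try reflexivity;
  try (f_equal; auto with arith; apply IHc; lia).
all: match type of H with
     | _ = ?k + 4 * ⟨?a, ?b⟩ =>
       match type of H with
       | _ + 4 * ⟨?a', ?b'⟩ = _ =>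
         assert (E : ⟨a', b'⟩ = ⟨a, b⟩) by lia; apply to_nat_inj in E;
         injection E as E1 E2; f_equal; auto
       end
     end.
Qed.

Lemma index_surj e : exists c, index c = e.
Proof.
induction e as [e IH] using lt_wf_ind.
destruct (Nat.lt_ge_cases e 5) as [He|He].
  do 5 (destruct e as [|e]; [first
    [exists Zero; reflexivity | exists Succ; reflexivity | exists Left; reflexivity
    | exists Right; reflexivity | exists Oracle; reflexivity]|]); lia.
pose (q := (e - 5) / 4); pose (r := (e - 5) mod 4).
assert (Er : e = 5 + r + 4 * q)
  by (pose proof (Nat.div_mod_eq (e - 5) 4); subst q r; lia).
assert (Hr : r < 4) by (apply Nat.mod_upper_bound; lia).
clearbody q r.
pose proof (cancel_to_of q) as Eq; destruct (of_nat q) as [a b].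
pose proof (to_nat_non_decreasing a b) as Hab.
destruct (IH a ltac:(lia)) as [f Hf]; destruct (IH b ltac:(lia)) as [g Hg].
destruct (IH q ltac:(lia)) as [h Hh].
destruct r as [|[|[|[|r]]]]; [exists (Pair f g)|exists (Comp f g)|exists (Prec f g)|exists (Mu h)|];
  cbn [index]; rewrite ?Hf, ?Hg, ?Hh; lia.
Qed.

(** The Turing jump: the set of e such that the e-th program with oracle [A]
    halts on input e. *)
Definition jump (A : nat -> Prop) (e : nat) : Prop :=
  exists c, index c = e /\ exists y, eval A c e y.

(** Codings of words, integers and pairs; all three are bijections onto [nat]. *)
Fixpoint word_code (p : list bool) : nat :=
  match p with
  | [] => 0
  | b :: q => 1 + Nat.b2n b + 2 * word_code q
  end.

Definition int_code (z : Z) : nat :=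
  if (0 <=? z)%Z then 2 * Z.to_nat z else 2 * Z.to_nat (- z) - 1.

Definition word_nat_code (pt : list bool * nat) : nat :=
  ⟨word_code (fst pt), snd pt⟩.

Definition nat_code (n : nat) : nat := n.

Lemma word_code_inj p q : word_code p = word_code q -> p = q.
Proof.
revert q; induction p as [|b p IH]; intros [|b' q]; cbn [word_code]; intros H;
  try reflexivity; try lia.
destruct b, b'; cbn in H; try lia; f_equal; apply IH; lia.
Qed.

Lemma word_code_surj n : exists p, word_code p = n.
Proof.
induction n as [n IH] using lt_wf_ind; destruct n as [|n]; [now exists []|].
pose proof (Nat.div2_odd n) as E; pose proof (Nat.le_div2_diag_l n).
destruct (IH (Nat.div2 n) ltac:(lia)) as [p Hp].
exists (Nat.odd n :: p); cbn [word_code]; lia.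
Qed.

Lemma int_code_inj z z' : int_code z = int_code z' -> z = z'.
Proof. unfold int_code; destruct (Z.leb_spec 0 z), (Z.leb_spec 0 z'); lia. Qed.

Lemma int_code_surj n : exists z, int_code z = n.
Proof.
pose proof (Nat.div2_odd n) as E; destruct (Nat.odd n); cbn [Nat.b2n] in E.
- exists (- Z.of_nat (S (Nat.div2 n)))%Z; unfold int_code.
  destruct (Z.leb_spec 0 (- Z.of_nat (S (Nat.div2 n)))); lia.
- exists (Z.of_nat (Nat.div2 n)); unfold int_code.
  destruct (Z.leb_spec 0 (Z.of_nat (Nat.div2 n))); lia.
Qed.

(** A partial function is a map into an option type, [None] meaning undefined.
    [cX] and [cY] are the codings of the domain and of the codomain. *)
Definition partial_recursive_in (A : nat -> Prop) {X Y : Type}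
    (cX : X -> nat) (cY : Y -> nat) (F : X -> option Y) : Prop :=
  exists c, forall x y, F x = Some y <-> eval A c (cX x) (cY y).

Definition recursive_in (A : nat -> Prop) {X Y : Type}
    (cX : X -> nat) (cY : Y -> nat) (f : X -> Y) : Prop :=
  partial_recursive_in A cX cY (fun x => Some (f x)).

Definition is_max (V : nat -> Prop) (m : nat) : Prop :=
  V m /\ forall k, V k -> k <= m.

(* Main.v *)
(** If [A'] computes [G], then the graph of [G] is Sigma_2 in [A]: [G p = z] iff
    some [w] satisfies an [A]-decidable condition [R(p, z, w, t)] for all [t].
    Enumerate the pairs [v = (z, w)] and move from [v] to [v + 1] whenever a
    stage [t] refutes [v]; the walk stops exactly when [G p] is defined, at a
    pair that carries the right value [z]. With [z+] and [z-] the positive and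
    negative parts of [z], the functions [(v + 1)^2 + z+] and [(v + 1)^2 + z-]
    increase with [v], so along the walk their maxima exist iff it stops, and
    then differ by [z].
    Conversely, [max f(p, .)] is the least [m] for which "some [f(p, t)] exceeds
    [m]" fails, and [A'] decides that Sigma_1 condition. *)
From Stdlib Require Import Arith Lia List ZArith Cantor ClassicalEpsilon.
Require Import Defs.
Import ListNotations.

(** * Closure properties of the total functions computable in an oracle *)

Definition computable (A : nat -> Prop) (f : nat -> nat) : Prop :=
  exists c, forall x, eval A c x (f x).

Definition p1 (x : nat) : nat := fst (of_nat x).
Definition p2 (x : nat) : nat := snd (of_nat x).

Lemma p1_pair x y : p1 ⟨x, y⟩ = x.
Proof. unfold p1; now rewrite cancel_of_to. Qed.

Lemma p2_pair x y : p2 ⟨x, y⟩ = y.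
Proof. unfold p2; now rewrite cancel_of_to. Qed.

Lemma pair_eta x : ⟨p1 x, p2 x⟩ = x.
Proof. unfold p1, p2; rewrite <- surjective_pairing; apply cancel_to_of. Qed.

Local Opaque to_nat of_nat.

Ltac unpair := repeat rewrite ?p1_pair, ?p2_pair.

Lemma eval_iff A c x v y : eval A c x v -> eval A c x y <-> y = v.
Proof.
intros H; split; [|now intros ->].
intros H'; exact (eval_functional _ _ _ _ _ H' H).
Qed.

Section Computable.
Variable A : nat -> Prop.

Lemma computable_ext f g : (forall x, f x = g x) -> computable A f -> computable A g.
Proof. intros E [c Hc]; exists c; intros x; rewrite <- E; apply Hc. Qed.

Lemma computable_comp f g :
  computable A f -> computable A g -> computable A (fun x => f (g x)).
Proof. intros [c Hc] [d Hd]; exists (Comp c d); intros x; exists (g x); auto. Qed.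

Lemma computable_id : computable A (fun x => x).
Proof.
exists (Pair Left Right); intros x; exists (p1 x), (p2 x).
repeat split; symmetry; apply pair_eta.
Qed.

Lemma computable_S f : computable A f -> computable A (fun x => S (f x)).
Proof. apply computable_comp; exists Succ; reflexivity. Qed.

Lemma computable_const k : computable A (fun _ => k).
Proof. induction k as [|k IH]; [exists Zero; reflexivity|now apply computable_S]. Qed.

Lemma computable_p1 f : computable A f -> computable A (fun x => p1 (f x)).
Proof. apply computable_comp; exists Left; reflexivity. Qed.

Lemma computable_p2 f : computable A f -> computable A (fun x => p2 (f x)).
Proof. apply computable_comp; exists Right; reflexivity. Qed.

Lemma computable_pair f g :
  computable A f -> computable A g -> computable A (fun x => ⟨f x, g x⟩).
Proof.
intros [c Hc] [d Hd]; exists (Pair c d); intros x; exists (f x), (g x); auto.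
Qed.

(** [Prec] keeps its parameter unchanged at every step, so taking [x] itself as the parameter lets
    [g] depend on [x]. *)
Lemma computable_rec b g n :
  computable A b -> computable A n ->
  computable A (fun z => g (p1 z) (p1 (p2 z)) (p2 (p2 z))) ->
  computable A (fun x => nat_rect (fun _ => nat) (b x) (fun m u => g x m u) (n x)).
Proof.
intros [cb Hb] [cn Hn] [cg Hg]; destruct computable_id as [i Hi].
exists (Comp (Prec cb cg) (Pair i cn)); intros x; cbn [eval].
exists ⟨x, n x⟩; split; [exists x, (n x); auto|].
rewrite cancel_of_to; cbn [fst snd].
induction (n x) as [|m IH]; cbn [prec_graph nat_rect]; [apply Hb|].
eexists; split; [exact IH|].
specialize (Hg ⟨x, ⟨m, nat_rect (fun _ => nat) (b x) (fun m u => g x m u) m⟩⟩).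
revert Hg; cbv beta; unpair; auto.
Qed.

Lemma computable_iter f b n :
  computable A (fun z => f (p1 z) (p2 z)) -> computable A b -> computable A n ->
  computable A (fun x => Nat.iter (n x) (f x) (b x)).
Proof.
intros Hf Hb Hn; apply (computable_rec b (fun x _ u => f x u) n Hb Hn).
apply (computable_ext (fun z => f (p1 ⟨p1 z, p2 (p2 z)⟩) (p2 ⟨p1 z, p2 (p2 z)⟩)));
  [intros z; now unpair|].
apply (computable_comp _ (fun z => ⟨p1 z, p2 (p2 z)⟩) Hf).
apply computable_pair; repeat (apply computable_p1 || apply computable_p2);
  apply computable_id.
Qed.

Lemma computable_pred f : computable A f -> computable A (fun x => pred (f x)).
Proof.
intros Hf.
apply (computable_ext (fun x => nat_rect (fun _ => nat) 0 (fun m _ => m) (f x))).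
  intros x; now destruct (f x).
apply (computable_rec (fun _ => 0) (fun _ m _ => m)); auto using computable_const,
  computable_p1, computable_p2, computable_id.
Qed.

Lemma computable_add f g :
  computable A f -> computable A g -> computable A (fun x => f x + g x).
Proof.
intros Hf Hg; apply (computable_ext (fun x => Nat.iter (g x) S (f x))).
  intros x; induction (g x) as [|n IH]; simpl; lia.
apply (computable_iter (fun _ => S)); auto using computable_S, computable_p2, computable_id.
Qed.

Lemma computable_sub f g :
  computable A f -> computable A g -> computable A (fun x => f x - g x).
Proof.
intros Hf Hg; apply (computable_ext (fun x => Nat.iter (g x) pred (f x))).
  intros x; induction (g x) as [|n IH]; simpl; lia.
apply (computable_iter (fun _ => pred)); auto using computable_pred, computable_p2, computable_id.
Qed.

Lemma computable_mul f g :
  computable A f -> computable A g -> computable A (fun x => f x * g x).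
Proof.
intros Hf Hg; apply (computable_ext (fun x => Nat.iter (g x) (Nat.add (f x)) 0)).
  intros x; induction (g x) as [|n IH]; simpl; lia.
apply computable_iter; auto using computable_const.
apply computable_add; [apply computable_comp; auto|];
  auto using computable_p1, computable_p2, computable_id.
Qed.

(** Truncated subtraction vanishes exactly when [f x <= g x]; recursion on it selects the base or
    the step. *)
Lemma computable_if_leb f g h k :
  computable A f -> computable A g -> computable A h -> computable A k ->
  computable A (fun x => if f x <=? g x then h x else k x).
Proof.
intros Hf Hg Hh Hk.
apply (computable_ext
         (fun x => nat_rect (fun _ => nat) (h x) (fun _ _ => k x) (f x - g x))).
{ intros x; destruct (Nat.leb_spec (f x) (g x)).
  - now replace (f x - g x) with 0 by lia.
  - now replace (f x - g x) with (S (pred (f x - g x))) by lia. }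
apply (computable_rec h (fun x _ _ => k x)); auto using computable_sub.
apply computable_comp; auto using computable_p1, computable_id.
Qed.

Lemma computable_if_eqb f g h k :
  computable A f -> computable A g -> computable A h -> computable A k ->
  computable A (fun x => if f x =? g x then h x else k x).
Proof.
intros Hf Hg Hh Hk.
apply (computable_ext
         (fun x => if f x - g x + (g x - f x) <=? 0 then h x else k x)).
  intros x; destruct (Nat.leb_spec (f x - g x + (g x - f x)) 0),
    (Nat.eqb_spec (f x) (g x)); auto; lia.
apply computable_if_leb; auto using computable_add, computable_sub, computable_const.
Qed.

Lemma computable_mod f k : k <> 0 -> computable A f -> computable A (fun x => f x mod k).
Proof.
intros Hk Hf.
apply (computable_ext
         (fun x => Nat.iter (f x) (fun r => if S r =? k then 0 else S r) 0)).
{ intros x; induction (f x) as [|n IH]; [now rewrite Nat.Div0.mod_0_l|].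
  rewrite Nat.iter_succ, IH; pose proof (Nat.mod_upper_bound n k Hk); pose proof (Nat.div_mod_eq n k).
  destruct (Nat.eqb_spec (S (n mod k)) k).
  - apply (Nat.mod_unique _ _ (S (n / k))); lia.
  - apply (Nat.mod_unique _ _ (n / k)); lia. }
apply (computable_iter (fun _ r => if S r =? k then 0 else S r));
  auto using computable_const.
apply computable_if_eqb; auto using computable_const, computable_S, computable_p2, computable_id.
Qed.

Lemma computable_div f k : k <> 0 -> computable A f -> computable A (fun x => f x / k).
Proof.
intros Hk Hf.
apply (computable_ext
  (fun x => nat_rect (fun _ => nat) 0 (fun n q => if S (n mod k) =? k then S q else q) (f x))).
{ intros x; induction (f x) as [|n IH]; cbn [nat_rect];
    [now rewrite Nat.Div0.div_0_l|].
  rewrite IH; pose proof (Nat.mod_upper_bound n k Hk); pose proof (Nat.div_mod_eq n k).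
  destruct (Nat.eqb_spec (S (n mod k)) k).
  - apply (Nat.div_unique _ _ _ 0); lia.
  - apply (Nat.div_unique _ _ _ (S (n mod k))); lia. }
apply (computable_rec (fun _ => 0) (fun _ n q => if S (n mod k) =? k then S q else q));
  auto using computable_const.
apply computable_if_eqb; auto using computable_const, computable_S, computable_mod,
  computable_p1, computable_p2, computable_id.
Qed.

End Computable.

Ltac comp :=
  cbv beta zeta;
  repeat lazymatch goal with
  | |- computable _ (fun x => x) => apply computable_id
  | |- computable _ (fun _ => ?c) => apply computable_const
  | |- computable _ (fun x => S _) => apply computable_S
  | |- computable _ (fun x => pred _) => apply computable_pred
  | H : computable ?A ?F |- computable ?A ?F => exact H
  | |- computable _ p1 => apply (computable_p1 _ (fun x => x))
  | |- computable _ p2 => apply (computable_p2 _ (fun x => x))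
  | |- computable _ (fun x => p1 _) => apply computable_p1
  | |- computable _ (fun x => p2 _) => apply computable_p2
  | |- computable _ (fun x => ⟨_, _⟩) => apply computable_pair
  | |- computable _ (fun x => _ + _) => apply computable_add
  | |- computable _ (fun x => _ - _) => apply computable_sub
  | |- computable _ (fun x => _ * _) => apply computable_mul
  | |- computable _ (fun x => _ / _) => apply computable_div; [discriminate|]
  | |- computable _ (fun x => _ mod _) => apply computable_mod; [discriminate|]
  | |- computable _ (fun x => if _ <=? _ then _ else _) => apply computable_if_leb
  | |- computable _ (fun x => if _ =? _ then _ else _) => apply computable_if_eqb
  | |- computable _ (fun x => Nat.iter _ _ _) => apply computable_iter; cbv beta
  | H : computable _ ?F |- computable _ (fun x => ?F (@?g x)) =>
      apply (computable_comp _ F g H)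
  end.

(** * Stage-uniform certificates for oracle computations *)

(** The machine checks a stack of claims about programs with oracle [B], taking
    from a certificate every value that has to be guessed. An oracle claim
    [B(x) = y] is accepted at stage [t] with guess [u] iff [Q] vanishes. Since the
    rest of a run does not depend on [t], one certificate has to work at all stages
    in [T]. Both uses of the machine fit: [B = A] with [T = {0}] (plain certificates,
    so the jump is Sigma_1) and [B = A'] with [T] everything (a Sigma_2 form). *)
Section Machine.
Variables A B T : nat -> Prop.
Variable Q : nat -> nat.

Inductive goal : Set :=
| Value (c : code) (x y : nat)
(* the part of an unbounded search that lies below its result *)
| Positive_below (c : code) (x y : nat).

Definition holds (g : goal) : Prop :=
  match g with
  | Value c x y => eval B c x y
  | Positive_below c x y => forall k, k < y -> exists v, eval B c ⟨x, k⟩ (S v)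
  end.

Definition check (b : bool) : option (list goal) := if b then Some [] else None.

(** The guess [u] supplies an intermediate value, the predecessor of a positive value, or an oracle
    witness; [None] is a rejection. *)
Definition reduce (t u : nat) (g : goal) : option (list goal) :=
  match g with
  | Value Zero x y => check (y =? 0)
  | Value Succ x y => check (y =? S x)
  | Value Left x y => check (y =? p1 x)
  | Value Right x y => check (y =? p2 x)
  | Value Oracle x y => check (Q ⟨⟨x, y⟩, ⟨u, t⟩⟩ =? 0)
  | Value (Pair f g) x y => Some [Value f x (p1 y); Value g x (p2 y)]
  | Value (Comp f g) x y => Some [Value g x u; Value f u y]
  | Value (Prec f g) x y =>
      match p2 x with
      | 0 => Some [Value f (p1 x) y]
      | S n => Some [Value (Prec f g) ⟨p1 x, n⟩ u; Value g ⟨p1 x, ⟨n, u⟩⟩ y]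
      end
  | Value (Mu f) x y => Some [Value f ⟨x, y⟩ 0; Positive_below f x y]
  | Positive_below f x 0 => Some []
  | Positive_below f x (S k) => Some [Value f ⟨x, k⟩ (S u); Positive_below f x k]
  end.

Definition value_code (e x y : nat) : nat := ⟨0, ⟨e, ⟨x, y⟩⟩⟩.
Definition positive_code (e x y : nat) : nat := ⟨1, ⟨e, ⟨x, y⟩⟩⟩.

Definition goal_code (g : goal) : nat :=
  match g with
  | Value c x y => value_code (index c) x y
  | Positive_below c x y => positive_code (index c) x y
  end.

(** Only the empty stack has code 0, which is how [step] recognises acceptance. *)
Fixpoint goals_code (l : list goal) : nat :=
  match l with
  | [] => 0
  | g :: l => S ⟨goal_code g, goals_code l⟩
  end.

(** A claim that cannot be reduced leaves the machine stuck, which loops. *)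
Definition step (t s : nat) : nat :=
  let h := p1 (pred (p1 s)) in
  let l := p2 (pred (p1 s)) in
  let u := p1 (p2 s) in
  let w := p2 (p2 s) in
  let e := p1 (p2 h) in
  let x := p1 (p2 (p2 h)) in
  let y := p2 (p2 (p2 h)) in
  let q := (e - 5) / 4 in
  let r := (e - 5) mod 4 in
  if p1 s =? 0 then s else
  if p1 h =? 1 then
    if y =? 0 then ⟨l, w⟩ else
    ⟨S ⟨value_code e ⟨x, pred y⟩ (S u), S ⟨positive_code e x (pred y), l⟩⟩, w⟩
  else
  if e =? 0 then if y =? 0 then ⟨l, w⟩ else s else
  if e =? 1 then if y =? S x then ⟨l, w⟩ else s else
  if e =? 2 then if y =? p1 x then ⟨l, w⟩ else s else
  if e =? 3 then if y =? p2 x then ⟨l, w⟩ else s else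
  if e =? 4 then if Q ⟨⟨x, y⟩, ⟨u, t⟩⟩ =? 0 then ⟨l, w⟩ else s else
  if r =? 0 then
    ⟨S ⟨value_code (p1 q) x (p1 y), S ⟨value_code (p2 q) x (p2 y), l⟩⟩, w⟩ else
  if r =? 1 then
    ⟨S ⟨value_code (p2 q) x u, S ⟨value_code (p1 q) u y, l⟩⟩, w⟩ else
  if r =? 2 then
    if p2 x =? 0 then ⟨S ⟨value_code (p1 q) (p1 x) y, l⟩, w⟩ else
    ⟨S ⟨value_code e ⟨p1 x, pred (p2 x)⟩ u,
      S ⟨value_code (p2 q) ⟨p1 x, ⟨pred (p2 x), u⟩⟩ y, l⟩⟩, w⟩
  else
    ⟨S ⟨value_code q ⟨x, y⟩ 0, S ⟨positive_code q x y, l⟩⟩, w⟩.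

Lemma computable_step :
  computable A Q -> computable A (fun z => step (p1 z) (p2 z)).
Proof. intros HQ; unfold step, value_code, positive_code; comp. Qed.

Definition state (l : list goal) (w : nat) : nat := ⟨goals_code l, w⟩.

Lemma node_div m q : 5 <= m < 9 -> (m + 4 * q - 5) / 4 = q.
Proof. intros H; symmetry; apply (Nat.div_unique _ _ _ (m - 5)); lia. Qed.

Lemma node_mod m q : 5 <= m < 9 -> (m + 4 * q - 5) mod 4 = m - 5.
Proof. intros H; symmetry; apply (Nat.mod_unique _ _ q); lia. Qed.

(** The arithmetic on codes simulates [reduce] on lists, so later arguments need only the latter. *)
Lemma step_state t g l u w :
  step t (state (g :: l) ⟨u, w⟩) =
  match reduce t u g with
  | Some l' => state (l' ++ l) w
  | None => state (g :: l) ⟨u, w⟩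
  end.
Proof.
unfold step, state; cbv zeta; cbn [goals_code]; unpair; cbn [pred Nat.eqb]; unpair.
destruct g as [c x y|c x y]; cbn [goal_code]; unfold value_code, positive_code;
  unpair; cbn [Nat.eqb].
- destruct c; cbn [index]; rewrite ?node_div, ?node_mod by lia;
    cbn [Nat.eqb Nat.add Nat.sub reduce check]; unpair; try reflexivity.
  all: unfold check.
  all: try match goal with |- (if ?b then _ else _) = _ => destruct b; reflexivity end.
  destruct (p2 x); reflexivity.
- destruct y; reflexivity.
Qed.

Hypothesis T0 : T 0.
Hypothesis oracle_form :
  forall x y, eval B Oracle x y <-> exists u, forall t, T t -> Q ⟨⟨x, y⟩, ⟨u, t⟩⟩ = 0.

Lemma check_Some b l : check b = Some l <-> b = true /\ l = [].
Proof. destruct b; cbn; intuition congruence. Qed.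

(** Only oracle claims consult the stage, and once accepted they leave no new claims behind. *)
Lemma reduce_stage t t' u g l l' :
  reduce t u g = Some l -> reduce t' u g = Some l' -> l = l'.
Proof.
destruct g as [[] x y|c x y]; cbn [reduce]; try congruence.
intros [_ ->]%check_Some [_ ->]%check_Some; reflexivity.
Qed.

Lemma reduce_sound u g l :
  (forall t, T t -> reduce t u g = Some l) -> Forall holds l -> holds g.
Proof.
intros Hr Hl; pose proof (Hr 0 T0) as H0.
destruct g as [[| | | | |f g|f g|f g|f] x y|c x y]; cbn [reduce] in H0.
- apply check_Some in H0; now apply Nat.eqb_eq.
- apply check_Some in H0; now apply Nat.eqb_eq.
- apply check_Some in H0; now apply Nat.eqb_eq.
- apply check_Some in H0; now apply Nat.eqb_eq.
- apply oracle_form; exists u; intros t Ht; specialize (Hr t Ht).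
  apply check_Some in Hr; now apply Nat.eqb_eq.
- injection H0 as <-; inversion_clear Hl as [|? ? H1 H2]; inversion_clear H2.
  exists (p1 y), (p2 y); rewrite pair_eta; auto.
- injection H0 as <-; inversion_clear Hl as [|? ? H1 H2]; inversion_clear H2.
  exists u; auto.
- cbn [holds eval]; fold (p1 x); fold (p2 x).
  destruct (p2 x) as [|n] eqn:E; injection H0 as <-;
    inversion_clear Hl as [|? ? H1 H2]; [exact H1|].
  inversion_clear H2; cbn [holds eval] in H1; rewrite cancel_of_to in H1.
  exists u; auto.
- injection H0 as <-; inversion_clear Hl as [|? ? H1 H2]; inversion_clear H2.
  split; auto.
- destruct y as [|y]; injection H0 as <-; intros k Hk; [lia|].
  inversion_clear Hl as [|? ? H1 H2]; inversion_clear H2 as [|? ? H3 _].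
  destruct (Nat.eq_dec k y) as [->|Hne]; [now exists u|apply H3; lia].
Qed.

(** The top claim must be accepted at every stage, and by [reduce_stage] the claims it leaves are
    the same at all stages, so the induction hypothesis applies to one common stack. *)
Lemma run_sound n l w :
  (forall t, T t -> p1 (Nat.iter n (step t) (state l w)) = 0) -> Forall holds l.
Proof.
revert l w; induction n as [|n IH]; intros [|g l] w H; [constructor| |constructor|].
- specialize (H 0 T0); cbn [Nat.iter nat_rect] in H; unfold state in H.
  now rewrite p1_pair in H.
- rewrite <- (pair_eta w) in H.
  assert (Hred : exists l', forall t, T t -> reduce t (p1 w) g = Some l').
  { assert (Hex : forall t, T t -> exists l', reduce t (p1 w) g = Some l').
    { intros t Ht; specialize (H t Ht).
      destruct (reduce t (p1 w) g) as [l'|] eqn:E; [now exists l'|exfalso].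
      (* A rejected claim freezes the state, so the stack could never become empty. *)
      rewrite (Nat.iter_invariant (S n) _ (step t) (fun s => s = state (g :: l) ⟨p1 w, p2 w⟩))
        in H; [|intros s ->; now rewrite step_state, E|reflexivity].
      unfold state in H; now rewrite p1_pair in H. }
    destruct (Hex 0 T0) as [l' E]; exists l'; intros t Ht.
    destruct (Hex t Ht) as [l'' E']; rewrite E'; f_equal.
    exact (reduce_stage _ _ _ _ _ _ E' E). }
  destruct Hred as [l' Hr].
  assert (Hl : Forall holds (l' ++ l)).
  { apply (IH _ (p2 w)); intros t Ht; specialize (H t Ht).
    now rewrite Nat.iter_succ_r, step_state, Hr in H. }
  apply Forall_app in Hl; destruct Hl as [Hl1 Hl2].
  constructor; [exact (reduce_sound _ _ _ Hr Hl1)|exact Hl2].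
Qed.

(** Quantifying over the stack below and the unread certificate lets runs be chained; [n] and [w']
    are chosen before [t], hence serve all stages. *)
Definition runs (g : goal) : Prop :=
  forall l w, exists n w', forall t, T t ->
  Nat.iter n (step t) (state (g :: l) w') = state l w.

Lemma runs_reduce u g gs :
  (forall t, T t -> reduce t u g = Some gs) -> Forall runs gs -> runs g.
Proof.
intros Hr Hgs l w.
assert (H : exists n w', forall t, T t ->
          Nat.iter n (step t) (state (gs ++ l) w') = state l w).
{ clear Hr; induction Hgs as [|h gs Hh _ IH]; [exists 0, w; reflexivity|].
  destruct IH as (n & w' & Hn); destruct (Hh (gs ++ l) w') as (m & w'' & Hm).
  exists (n + m), w''; intros t Ht; rewrite Nat.iter_add; cbn [app].
  now rewrite Hm, Hn. }
destruct H as (n & w' & Hn); exists (S n), ⟨u, w'⟩; intros t Ht.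
rewrite Nat.iter_succ_r, step_state, Hr by exact Ht; auto.
Qed.

(** Completeness of the machine, by induction on the program, with an inner induction on the
    recursion counter for [Prec] and on the search bound for [Mu]. *)
Lemma value_runs c x y : eval B c x y -> runs (Value c x y).
Proof.
revert x y; induction c as [| | | | |f IHf g IHg|f IHf g IHg|f IHf g IHg|f IHf];
  intros x y H.
- apply (runs_reduce 0 _ []); [intros t _; apply check_Some|constructor].
  split; [now apply Nat.eqb_eq|reflexivity].
- apply (runs_reduce 0 _ []); [intros t _; apply check_Some|constructor].
  split; [now apply Nat.eqb_eq|reflexivity].
- apply (runs_reduce 0 _ []); [intros t _; apply check_Some|constructor].
  split; [now apply Nat.eqb_eq|reflexivity].
- apply (runs_reduce 0 _ []); [intros t _; apply check_Some|constructor].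
  split; [now apply Nat.eqb_eq|reflexivity].
- apply oracle_form in H; destruct H as [u Hu].
  apply (runs_reduce u _ []); [intros t Ht; apply check_Some|constructor].
  split; [apply Nat.eqb_eq; auto|reflexivity].
- destruct H as (u & v & Hu & Hv & ->).
  apply (runs_reduce 0 _ [Value f x u; Value g x v]); [|auto].
  intros t _; cbn [reduce]; now unpair.
- destruct H as (u & Hu & Hy).
  apply (runs_reduce u _ [Value g x u; Value f u y]); [reflexivity|auto].
- cbn [eval] in H; fold (p1 x) (p2 x) in H; rewrite <- (pair_eta x).
  generalize dependent y; induction (p2 x) as [|n IHn]; intros y H.
  + apply (runs_reduce 0 _ [Value f (p1 x) y]); [|auto].
    intros t _; cbn [reduce]; now unpair.
  + destruct H as (u & Hu & Hy).
    apply (runs_reduce u _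
             [Value (Prec f g) ⟨p1 x, n⟩ u; Value g ⟨p1 x, ⟨n, u⟩⟩ y]); [|auto].
    intros t _; cbn [reduce]; now unpair.
- destruct H as [H0 Hlt].
  apply (runs_reduce 0 _ [Value f ⟨x, y⟩ 0; Positive_below f x y]); [reflexivity|].
  repeat constructor; auto.
  clear H0; induction y as [|y IHy]; [now apply (runs_reduce 0 _ [])|].
  destruct (Hlt y (Nat.lt_succ_diag_r y)) as [v Hv].
  apply (runs_reduce v _ [Value f ⟨x, y⟩ (S v); Positive_below f x y]); [reflexivity|].
  repeat constructor; [now apply IHf|apply IHy; auto].
Qed.

(** The witness [w] packs a running time with a certificate; [R] returns the code of the stack left
    after that time. *)
Lemma normal_form : computable A Q ->
  exists R, computable A R /\ forall c x y,
  eval B c x y <->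
  exists w, forall t, T t -> R ⟨⟨index c, ⟨x, y⟩⟩, ⟨w, t⟩⟩ = 0.
Proof.
intros HQ.
pose (start z := ⟨S ⟨value_code (p1 (p1 z)) (p1 (p2 (p1 z))) (p2 (p2 (p1 z))), 0⟩,
                  p2 (p1 (p2 z))⟩).
exists (fun z => p1 (Nat.iter (p1 (p1 (p2 z))) (step (p2 (p2 z))) (start z))); split.
{ apply computable_p1, (computable_iter A (fun z => step (p2 (p2 z))));
    [|unfold start, value_code; comp|comp].
  apply (computable_ext A (fun z => (fun z => step (p1 z) (p2 z)) ⟨p2 (p2 (p1 z)), p2 z⟩)).
  - intros z; now unpair.
  - apply (computable_comp A (fun z => step (p1 z) (p2 z))); [now apply computable_step|comp]. }
intros c x y; transitivity (exists w, forall t, T t ->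
  p1 (Nat.iter (p1 w) (step t) (state [Value c x y] (p2 w))) = 0).
- split.
  + intros H; destruct (value_runs _ _ _ H [] 0) as (n & w & Hw).
    exists ⟨n, w⟩; intros t Ht; unpair; rewrite Hw by exact Ht; apply p1_pair.
  + intros [w Hw]; apply run_sound in Hw; now inversion Hw.
- split; intros [w Hw]; exists w; intros t Ht; specialize (Hw t Ht); revert Hw;
    unfold start; now unpair.
Qed.

End Machine.

(** * Enumerability of the jump and a two-quantifier form of computations in it *)

Lemma least_witness (P : nat -> Prop) n :
  P n -> exists m, P m /\ forall k, k < m -> ~ P k.
Proof.
induction n as [n IH] using lt_wf_ind; intros Hn.
destruct (classic (exists k, k < n /\ P k)) as [(k & Hk & HP)|Hno]; [eauto|].
exists n; split; [exact Hn|]; intros k Hk HP; eauto.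
Qed.

(** Halting asks for some output and a certificate for it; one number codes both. *)
Lemma jump_enumerable A :
  exists r, computable A r /\ forall e, jump A e <-> exists w, r ⟨e, w⟩ = 0.
Proof.
pose (chi x := if excluded_middle_informative (A x) then 1 else 0).
assert (Hchi : computable A chi).
{ exists Oracle; intros x; unfold chi; cbn [eval].
  destruct (excluded_middle_informative (A x)); auto. }
destruct (normal_form A A (eq 0) (fun z => if chi (p1 (p1 z)) =? p2 (p1 z) then 0 else 1))
  as (R & HR & Hev).
- reflexivity.
- intros x y; unfold chi; transitivity (chi x = y).
  + unfold chi; cbn [eval]; destruct (excluded_middle_informative (A x)); intuition.
  + split; [intros E; exists 0; intros t _|intros [u Hu]; specialize (Hu 0 eq_refl); revert Hu];
      unpair; fold (chi x); destruct (Nat.eqb_spec (chi x) y); auto; easy.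
- comp.
- exists (fun z => R ⟨⟨p1 z, ⟨p1 z, p1 (p2 z)⟩⟩, ⟨p2 (p2 z), 0⟩⟩); split; [comp|].
  intros e; split.
  + intros (c & <- & y & Hy); apply Hev in Hy; destruct Hy as [w Hw].
    exists ⟨y, w⟩; unpair; auto.
  + intros [w Hw]; revert Hw; unpair; intros Hw.
    destruct (index_surj e) as [c <-]; exists c; split; [reflexivity|].
    exists (p1 w); apply Hev; exists (p2 w); now intros _ <-.
Qed.

Lemma limit_form A :
  exists R, computable A R /\ forall c x y,
  eval (jump A) c x y <-> exists w, forall t, R ⟨⟨index c, ⟨x, y⟩⟩, ⟨w, t⟩⟩ = 0.
Proof.
destruct (jump_enumerable A) as (r & Hr & Hjump).
destruct (normal_form A (jump A) (fun _ => True)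
  (* The answer 1 is checked against the guessed halting witness, the answer 0 against the stage as
     a possible counterexample; other answers fail. *)
  (fun z => if p2 (p1 z) =? 1 then r ⟨p1 (p1 z), p1 (p2 z)⟩ else
            if p2 (p1 z) =? 0 then if r ⟨p1 (p1 z), p2 (p2 z)⟩ =? 0 then 1 else 0
            else 1)) as (R & HR & Hev).
- exact I.
- intros x y; cbn [eval]; rewrite Hjump; split.
  + intros [[[w Hw] ->]|[Hno ->]].
    * exists w; intros t _; now unpair.
    * exists 0; intros t _; unpair; cbn [Nat.eqb].
      destruct (Nat.eqb_spec (r ⟨x, t⟩) 0); [exfalso; eauto|reflexivity].
  + intros [u Hu]; destruct y as [|[|y]].
    * right; split; [|reflexivity]; intros [w Hw]; specialize (Hu w I).
      revert Hu; unpair; cbn [Nat.eqb]; now rewrite Hw.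
    * left; split; [|reflexivity]; exists u; specialize (Hu 0 I).
      revert Hu; now unpair.
    * specialize (Hu 0 I); revert Hu; now unpair.
- comp.
- exists R; split; [exact HR|]; intros c x y; rewrite Hev.
  split; intros [w Hw]; exists w; auto.
Qed.

(** * The walk through successive candidates and its final point *)

Section Walk.
Variable R : nat -> nat.

(** A state pairs a candidate with the stage to test next; a refutation resets the stage, so the
    next candidate is tested from stage 0. *)
Definition advance (x s : nat) : nat :=
  if R ⟨x, s⟩ =? 0 then ⟨p1 s, S (p2 s)⟩ else ⟨S (p1 s), 0⟩.

Definition walk (x t : nat) : nat := Nat.iter t (advance x) ⟨0, 0⟩.

Definition refuted (x v : nat) : Prop := exists t, R ⟨x, ⟨v, t⟩⟩ <> 0.

Definition final (x v : nat) : Prop :=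
  (forall u, u < v -> refuted x u) /\ ~ refuted x v.

(** The walk leaves a candidate only on refuting it, and by testing stages in order it finds any
    refutation. *)
Lemma walk_reaches x v :
  (exists t, v = p1 (walk x t)) <-> forall u, u < v -> refuted x u.
Proof.
split.
- intros [t ->]; induction t as [|t IH]; intros u Hu.
  + unfold walk in Hu; cbn [Nat.iter nat_rect] in Hu; rewrite p1_pair in Hu; lia.
  + unfold walk in Hu, IH; rewrite Nat.iter_succ in Hu.
    revert Hu IH; generalize (Nat.iter t (advance x) ⟨0, 0⟩); intros s Hu IH.
    unfold advance in Hu; destruct (Nat.eqb_spec (R ⟨x, s⟩) 0) as [E|E];
      rewrite p1_pair in Hu; [auto|].
    destruct (Nat.eq_dec u (p1 s)) as [->|Hne]; [|apply IH; lia].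
    exists (p2 s); now rewrite pair_eta.
- intros Hv.
  (* Arrival at stage 0 is the stronger statement that carries the induction. *)
  enough (exists t, walk x t = ⟨v, 0⟩) as [t E] by (exists t; now rewrite E, p1_pair).
  induction v as [|v IH]; [now exists 0|].
  destruct IH as [t0 E0]; [auto|].
  destruct (Hv v (Nat.lt_succ_diag_r v)) as [s Hs].
  (* This avoids locating the first refuting stage: either stage [k] is reached or the walk has
     already moved on. *)
  assert (H : forall k, (exists t, walk x t = ⟨v, k⟩) \/ exists t, walk x t = ⟨S v, 0⟩).
  { induction k as [|k IHk]; [eauto|].
    destruct IHk as [[t E]|IHk]; [|auto].
    destruct (Nat.eq_dec (R ⟨x, ⟨v, k⟩⟩) 0) as [D|D]; [left|right]; exists (S t);
      unfold walk; rewrite Nat.iter_succ; fold (walk x t); rewrite E;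
      unfold advance; apply Nat.eqb_eq in D || apply Nat.eqb_neq in D;
      rewrite D; now unpair. }
  destruct (H s) as [[t E]|]; [|assumption].
  exists (S t); unfold walk; rewrite Nat.iter_succ; fold (walk x t); rewrite E.
  unfold advance; apply Nat.eqb_neq in Hs; rewrite Hs; now unpair.
Qed.

Lemma final_unique x v v' : final x v -> final x v' -> v = v'.
Proof.
intros [H1 H2] [H1' H2']; destruct (Nat.lt_trichotomy v v') as [H|[H|H]];
  [now apply H1' in H|exact H|now apply H1 in H].
Qed.

Lemma final_exists x v : ~ refuted x v -> exists v', final x v'.
Proof.
intros H; destruct (least_witness (fun v => ~ refuted x v) v H) as (m & Hm & Hlt).
exists m; split; [|exact Hm]; intros u Hu; apply NNPP, Hlt, Hu.
Qed.

(** The visited candidates form an initial segment by [walk_reaches]; an increasing [phi] has a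
    maximum there iff the segment has a last element, which is then unrefuted. *)
Lemma is_max_walk (phi : nat -> nat) x m :
  (forall v, phi v < phi (S v)) ->
  is_max (fun k => exists t, k = phi (p1 (walk x t))) m <->
  exists v, final x v /\ m = phi v.
Proof.
intros Hphi.
assert (Hmono : forall u v, u <= v -> phi u <= phi v).
{ intros u v H; induction H as [|v H IH]; [lia|specialize (Hphi v); lia]. }
split.
- intros [[t ->] Hmax]; exists (p1 (walk x t)); split; [|reflexivity].
  assert (Hv : forall u, u < p1 (walk x t) -> refuted x u) by (apply walk_reaches; eauto).
  split; [exact Hv|]; intros Href.
  assert (Hr : exists t', S (p1 (walk x t)) = p1 (walk x t')).
  { apply walk_reaches; intros u Hu.
    destruct (Nat.eq_dec u (p1 (walk x t))) as [->|]; [exact Href|apply Hv; lia]. }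
  destruct Hr as [t' E]; specialize (Hmax _ (ex_intro _ t' eq_refl)).
  rewrite <- E in Hmax; specialize (Hphi (p1 (walk x t))); lia.
- intros (v & [Hv Hno] & ->); split.
  + apply walk_reaches in Hv; destruct Hv as [t E]; exists t; now rewrite E.
  + intros k [t ->]; apply Hmono.
    assert (Ht : forall u, u < p1 (walk x t) -> refuted x u) by (apply walk_reaches; eauto).
    destruct (Nat.le_gt_cases (p1 (walk x t)) v) as [|H]; [assumption|].
    now apply Ht in H.
Qed.

Lemma computable_walk A :
  computable A R -> computable A (fun z => walk (p1 z) (p2 z)).
Proof. intros HR; unfold walk, advance; comp. Qed.

End Walk.

(** Candidates pair an output with a witness for [limit_form]. Every unrefuted one carries a correct
    output, and outputs are unique, so stopping at the least is harmless. *)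
Lemma limit_walk A c :
  exists R, computable A R /\ forall x y,
  eval (jump A) c x y <-> exists v, final R x v /\ y = p1 v.
Proof.
destruct (limit_form A) as (R & HR & Hev).
exists (fun z => R ⟨⟨index c, ⟨p1 z, p1 (p1 (p2 z))⟩⟩, ⟨p2 (p1 (p2 z)), p2 (p2 z)⟩⟩).
split; [comp|].
set (R' := fun z => _).
assert (Hval : forall x v, ~ refuted R' x v -> eval (jump A) c x (p1 v)).
{ intros x v Hv; apply Hev; exists (p2 v); intros t.
  apply NNPP; intros Ht; apply Hv; exists t; unfold R'; now unpair. }
intros x y; split.
- intros H; pose proof H as H'; apply Hev in H'; destruct H' as [w Hw].
  destruct (final_exists R' x ⟨y, w⟩) as [v Hv].
  { intros [t Ht]; apply Ht; unfold R'; unpair; apply Hw. }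
  exists v; split; [exact Hv|].
  exact (eval_functional _ _ _ _ _ H (Hval _ _ (proj2 Hv))).
- intros (v & Hv & ->); exact (Hval _ _ (proj2 Hv)).
Qed.

(** * Signed parts of integers and transfer along the codings *)

(** In [int_code] an even [n] stands for [n / 2] and an odd [n] for [-(n / 2 + 1)]; these are the
    positive and negative parts. *)
Definition int_pos (n : nat) : nat := if n mod 2 =? 0 then n / 2 else 0.
Definition int_neg (n : nat) : nat := if n mod 2 =? 0 then 0 else S (n / 2).

Lemma int_code_split n : int_code (Z.of_nat (int_pos n) - Z.of_nat (int_neg n)) = n.
Proof.
unfold int_code, int_pos, int_neg.
pose proof (Nat.div_mod_eq n 2); pose proof (Nat.mod_upper_bound n 2).
destruct (Nat.eqb_spec (n mod 2) 0).
- destruct (Z.leb_spec 0 (Z.of_nat (n / 2) - Z.of_nat 0)); lia.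
- destruct (Z.leb_spec 0 (Z.of_nat 0 - Z.of_nat (S (n / 2)))); lia.
Qed.

Lemma int_pos_le n : int_pos n <= n.
Proof.
unfold int_pos; pose proof (Nat.div_mod_eq n 2); destruct (n mod 2 =? 0); lia.
Qed.

Lemma int_neg_le n : int_neg n <= n.
Proof.
unfold int_neg; pose proof (Nat.div_mod_eq n 2); destruct (Nat.eqb_spec (n mod 2) 0); lia.
Qed.

Lemma p1_le v : p1 v <= v.
Proof.
pose proof (to_nat_non_decreasing (p1 v) (p2 v)) as H; rewrite pair_eta in H; lia.
Qed.

(** The squares differ by [2 * v + 3], while [d] can drop by at most [v]. *)
Lemma square_add_increasing (d : nat -> nat) v :
  (forall u, d u <= u) -> S v * S v + d v < S (S v) * S (S v) + d (S v).
Proof. intros H; specialize (H v); nia. Qed.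

Lemma computable_recursive_in A F :
  computable A F -> recursive_in A word_nat_code nat_code (fun pt => F (word_nat_code pt)).
Proof.
intros [c Hc]; exists c; intros pt y; rewrite (eval_iff _ _ _ _ _ (Hc _)).
unfold nat_code; split; congruence.
Qed.

(** The codes of the arguments exhaust the naturals, so a program for [f] halts on every input and
    defines a total [F]. *)
Lemma recursive_in_computable A f :
  recursive_in A word_nat_code nat_code f ->
  exists F, computable A F /\ forall p t, f (p, t) = F ⟨word_code p, t⟩.
Proof.
intros [c Hc].
assert (Hev : forall pt, eval A c (word_nat_code pt) (f pt)) by (intros; now apply Hc).
assert (Hsurj : forall x, exists pt, word_nat_code pt = x).
{ intros x; destruct (word_code_surj (p1 x)) as [p Hp]; exists (p, p2 x).
  unfold word_nat_code; cbn [fst snd]; rewrite Hp; apply pair_eta. }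
assert (HF : forall x, {y | eval A c x y}).
{ intros x; apply constructive_indefinite_description.
  destruct (Hsurj x) as [pt <-]; eauto. }
exists (fun x => proj1_sig (HF x)); split.
- exists c; intros x; exact (proj2_sig (HF x)).
- intros p t; exact (eval_functional _ _ _ _ _ (Hev (p, t)) (proj2_sig (HF _))).
Qed.

(** * Maxima computed from the jump *)

Fixpoint const_code (k : nat) : code :=
  match k with 0 => Zero | S k => Comp Succ (const_code k) end.

Lemma eval_const_code A k x y : eval A (const_code k) x y <-> y = k.
Proof.
apply eval_iff; induction k as [|k IH]; [reflexivity|].
exists k; split; [exact IH|reflexivity].
Qed.

(** Whether some value exceeds [m] becomes a halting question about a program that ignores its
    input, so running it on its own index does no harm. *)
Lemma jump_max A F :
  computable A F ->
  exists c, forall x m,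
  eval (jump A) c x m <-> is_max (fun k => exists t, k = F ⟨x, t⟩) m.
Proof.
intros HF.
assert (HD : computable A
  (fun z => if S (p2 (p1 z)) <=? F ⟨p1 (p1 z), p2 z⟩ then 0 else 1)) by comp.
destruct HD as [d Hd].
(* program [s k] ignores its input and searches for [t] with [d⟨k, t⟩ = 0] *)
pose (s k := index (Comp (Mu d) (const_code k))).
assert (Hs : computable (jump A) s).
(* Prefixing [Comp Succ] turns an index [i] into [6 + 4 * ⟨1, i⟩], since [Succ] has index 1; the
   iteration starts at the index 0 of [Zero]. *)
{ apply (computable_ext _
    (fun k => 6 + 4 * ⟨index (Mu d), Nat.iter k (fun i => 6 + 4 * ⟨1, i⟩) 0⟩)); [|comp].
  assert (E : forall k, Nat.iter k (fun i => 6 + 4 * ⟨1, i⟩) 0 = index (const_code k)).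
  { induction k as [|k IH]; [reflexivity|]; now rewrite Nat.iter_succ, IH. }
  intros k; rewrite E; reflexivity. }
assert (Hd0 : forall x m t, eval A d ⟨⟨x, m⟩, t⟩ 0 <-> m < F ⟨x, t⟩).
{ intros x m t; rewrite (eval_iff _ _ _ _ _ (Hd _)); unpair.
  destruct (Nat.leb_spec (S m) (F ⟨x, t⟩)); lia. }
assert (Hjump : forall x m, jump A (s ⟨x, m⟩) <-> exists t, m < F ⟨x, t⟩).
{ intros x m; transitivity (exists t, eval A (Mu d) ⟨x, m⟩ t).
  - split.
    + intros (c & E & t & Ht); apply index_inj in E; subst c.
      destruct Ht as (k & Hk & Ht); apply eval_const_code in Hk; subst k; eauto.
    + intros [t Ht]; eexists; split; [reflexivity|]; exists t, ⟨x, m⟩.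
      split; [now apply eval_const_code|exact Ht].
  - split.
    + intros (t & Ht & _); exists t; now apply Hd0.
    + intros [t0 Ht0]; destruct (least_witness (fun t => m < F ⟨x, t⟩) t0 Ht0) as (t & Ht & Hlt).
      exists t; split; [now apply Hd0|]; intros k Hk; exists 0.
      specialize (Hlt k Hk); apply (eval_iff _ _ _ _ _ (Hd _)); unpair.
      destruct (Nat.leb_spec (S m) (F ⟨x, k⟩)); [contradiction|reflexivity]. }
(* The oracle answers 1 while some value exceeds [k]; the search stops at the first answer 0. *)
destruct Hs as [cs Hcs]; exists (Mu (Comp Oracle cs)); intros x m.
transitivity (~ (exists t, m < F ⟨x, t⟩) /\ forall k, k < m -> exists t, k < F ⟨x, t⟩).
- assert (H : forall k v, eval (jump A) (Comp Oracle cs) ⟨x, k⟩ v <->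
    eval (jump A) Oracle (s ⟨x, k⟩) v).
  { intros k v; split.
    - intros (u & Hu & Hv); now rewrite (eval_functional _ _ _ _ _ (Hcs _) Hu).
    - intros Hv; exists (s ⟨x, k⟩); auto. }
  split.
  + intros [H0 Hlt]; split.
    * apply H in H0; rewrite <- Hjump; destruct H0 as [[_ [=]]|[H0 _]]; exact H0.
    * intros k Hk; destruct (Hlt k Hk) as [v Hv]; apply H in Hv.
      rewrite <- Hjump; destruct Hv as [[Hv _]|[_ [=]]]; exact Hv.
  + intros [H0 Hlt]; split.
    * apply H; right; now rewrite Hjump.
    * intros k Hk; exists 0; apply H; left; rewrite Hjump; auto.
- split.
  + intros [Hno Hlt]; split.
    (* The bound is attained: for 0 no value is positive, and for [S m] some value exceeds [m] but
       none exceeds [S m]. *)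
    * destruct m as [|m].
      -- exists 0; destruct (F ⟨x, 0⟩) eqn:E; [reflexivity|].
         exfalso; apply Hno; exists 0; lia.
      -- destruct (Hlt m (Nat.lt_succ_diag_r m)) as [t Ht]; exists t.
         apply Nat.le_antisymm; [exact Ht|]; apply Nat.nlt_ge; eauto.
    * intros k [t ->]; apply Nat.nlt_ge; eauto.
  + intros [[t ->] Hmax]; split; [|eauto].
    intros [t' Ht']; specialize (Hmax _ (ex_intro _ t' eq_refl)); lia.
Qed.

Theorem theorem1p6 (A : nat -> Prop) (G : list bool -> option Z) :
  partial_recursive_in (jump A) word_code int_code G <->
  exists f g : list bool * nat -> nat,
    recursive_in A word_nat_code nat_code f /\
    recursive_in A word_nat_code nat_code g /\
    forall (p : list bool) (z : Z),
      G p = Some z <->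
      exists m n : nat,
        is_max (fun k => exists t, k = f (p, t)) m /\
        is_max (fun k => exists t, k = g (p, t)) n /\
        z = (Z.of_nat m - Z.of_nat n)%Z.
Proof.
split.
- intros [c Hc]; destruct (limit_walk A c) as (R & HR & Hev).
  pose (W z := walk R (p1 z) (p2 z)).
  pose proof (computable_walk R A HR : computable A W) as HW.
  (* [p1 v <= v], so the square outweighs the integer part *)
  pose (value d v := S v * S v + d (p1 v)).
  assert (Hmax : forall d x m, (forall n, d n <= n) ->
    is_max (fun k => exists t, k = value d (p1 (W ⟨x, t⟩))) m <->
    exists v, final R x v /\ m = value d v).
  { intros d x m Hd; rewrite <- is_max_walk.
    - unfold is_max; split; intros [[t E] H]; (split; [exists t|intros k [u Ek]; apply H; exists u]);
        [revert E|revert Ek|revert E|revert Ek]; unfold W; now unpair.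
    - intros v; apply (square_add_increasing (fun v => d (p1 v))); intros u.
      etransitivity; [apply Hd|apply p1_le]. }
  exists (fun pt => value int_pos (p1 (W (word_nat_code pt)))),
    (fun pt => value int_neg (p1 (W (word_nat_code pt)))).
  split; [|split].
  + apply (computable_recursive_in A (fun z => value int_pos (p1 (W z)))).
    unfold value, int_pos; comp.
  + apply (computable_recursive_in A (fun z => value int_neg (p1 (W z)))).
    unfold value, int_neg; comp.
  + intros p z; rewrite Hc, Hev; unfold word_nat_code; cbn [fst snd]; split.
    * intros (v & Hv & E).
      exists (value int_pos v), (value int_neg v).
      split; [apply Hmax; eauto using int_pos_le|].
      split; [apply Hmax; eauto using int_neg_le|].
      (* Both values contain the same square, which cancels and leaves the positive part minus the
         negative part. *)
      apply int_code_inj; rewrite E, <- (int_code_split (p1 v)) at 1.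
      f_equal; unfold value; lia.
    * intros (m & n & Hm & Hn & ->).
      apply Hmax in Hm, Hn; auto using int_pos_le, int_neg_le.
      destruct Hm as (v & Hv & ->), Hn as (v' & Hv' & ->).
      (* Both maxima sit at final candidates, and there is only one. *)
      rewrite (final_unique R _ _ _ Hv' Hv); exists v; split; [exact Hv|].
      rewrite <- (int_code_split (p1 v)); f_equal; unfold value; lia.
- intros (f & g & Hf & Hg & HG).
  apply recursive_in_computable in Hf, Hg.
  destruct Hf as (F1 & HF1 & Ef), Hg as (F2 & HF2 & Eg).
  destruct (jump_max A F1 HF1) as [c1 Hc1], (jump_max A F2 HF2) as [c2 Hc2].
  (* The branches follow the two clauses of [int_code]. Composed with [Pair c1 c2], the program
     halts only if both maxima exist. *)
  assert (HD : computable (jump A) (fun z =>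
    if p2 z <=? p1 z then 2 * (p1 z - p2 z) else 2 * (p2 z - p1 z) - 1)) by comp.
  destruct HD as [d Hd]; exists (Comp d (Pair c1 c2)); intros p z; rewrite HG.
  assert (Hdiff : forall m n, eval (jump A) d ⟨m, n⟩ (int_code (Z.of_nat m - Z.of_nat n))).
  { intros m n; apply (eval_iff _ _ _ _ _ (Hd _)); unpair; unfold int_code.
    destruct (Nat.leb_spec n m), (Z.leb_spec 0 (Z.of_nat m - Z.of_nat n)); lia. }
  assert (Hext : forall h F, (forall p t, h (p, t) = F ⟨word_code p, t⟩) -> forall m,
    is_max (fun k => exists t, k = h (p, t)) m <->
    is_max (fun k => exists t, k = F ⟨word_code p, t⟩) m).
  { intros h F E m; unfold is_max; setoid_rewrite E; reflexivity. }
  setoid_rewrite (Hext f F1 Ef); setoid_rewrite (Hext g F2 Eg).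
  setoid_rewrite <- Hc1; setoid_rewrite <- Hc2; split.
  + intros (m & n & Hm & Hn & ->); exists ⟨m, n⟩; split; [exists m, n; auto|apply Hdiff].
  + intros (u & (m & n & Hm & Hn & ->) & Hz); exists m, n; split; [exact Hm|]; split; [exact Hn|].
    apply int_code_inj, (eval_functional _ _ _ _ _ Hz (Hdiff m n)).
Qed.
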